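(* For all integers $r, k \geq 2$, we have $s_r(K_{k+1}) = P_r(k)$.
   Context: All graphs are finite and simple. For graphs $G,H$ and an integer $r\ge 1$, write $G \rightarrow (H)_r$ if every colouring of the edges of $G$ with $r$ colours contains a monochromatic copy of $H$. A graph $G$ is $r$-Ramsey-minimal for $H$ if $G \rightarrow (H)_r$ but no proper subgraph $G'\subsetneq G$ satisfies $G' \rightarrow (H)_r$. Define $s_r(H) := \min \delta(G)$ over all graphs $G$ that are $r$-Ramsey-minimal for $H$, where $\delta$ denotes minimum degree. A colour pattern on a vertex set $V$ is a sequence $G_1,\dots,G_r$ of pairwise edge-disjoint graphs all having vertex set $V$; it is $H$-free if no $G_i$ contains $H$ as a subgraph. Given a colour pattern $G_1,\dots,G_r$ on $V$ and a colouring $c: V \to [r]$ of the vertices, a strongly monochromatic $K_k$ is a set of $k$ vertices all receiving the same colour $i$ under $c$ and forming a clique in $G_i$. The $r$-colour $k$-clique packing number $P_r(k)$ is the smallest integer $n$ such that there exists a $K_{k+1}$-free colour pattern $G_1,\dots,G_r$ on an $n$-element vertex set $V$ such that every colouring $V \to [r]$ yields a strongly monochromatic $K_k$. *)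

(* Defs.v *)
From mathcomp Require Import all_boot.
Set Implicit Arguments. Unset Strict Implicit. Unset Printing Implicit Defensive.

Definition simple_graph (T : finType) (e : rel T) : Prop :=
  (forall x y, e x y = e y x) /\ (forall x, ~~ e x x).

(* The graph (A, e) (vertex set A, edge relation e whose edges lie in A)
   arrows K_m with r colours: every r-colouring of its edges (a symmetric
   colour function on pairs; only values on edges matter) contains a
   monochromatic copy of K_m, i.e. an injective map 'I_m -> A whose images are
   pairwise adjacent with all these edges of one colour i. *)
Definition arrows_clique (r m : nat) (T : finType) (A : {set T}) (e : rel T) : Prop :=
  forall c : T -> T -> 'I_r, (forall x y, c x y = c y x) ->
  exists (i : 'I_r) (f : 'I_m -> T),
    injective f /\ (forall a, f a \in A) /\
    (forall a b, a != b -> e (f a) (f b) /\ c (f a) (f b) = i).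

Definition ramsey_minimal (r m N : nat) (e : rel 'I_N) : Prop :=
  simple_graph e /\ arrows_clique r m [set: 'I_N] e /\
  forall (A : {set 'I_N}) (e' : rel 'I_N),
    simple_graph e' ->
    (forall x y, e' x y -> e x y) ->
    (forall x y, e' x y -> (x \in A) /\ (y \in A)) ->
    (A != [set: 'I_N] \/ exists x y, e x y && ~~ e' x y) ->
    ~ arrows_clique r m A e'.

Definition degree (N : nat) (e : rel 'I_N) (v : 'I_N) : nat := #|[set u | e v u]|.

Definition min_degree (N : nat) (e : rel 'I_N) (d : nat) : Prop :=
  (exists v, degree e v = d) /\ (forall v, d <= degree e v).

Definition sr_value (r m d : nat) : Prop :=
  exists (N : nat) (e : rel 'I_N), ramsey_minimal r m e /\ min_degree e d.

Definition packing_ok (r k n : nat) : Prop :=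
  exists g : 'I_r -> rel 'I_n,
    (forall i, simple_graph (g i)) /\
    (forall i j x y, g i x y -> g j x y -> i = j) /\
    (forall (i : 'I_r) (f : 'I_k.+1 -> 'I_n),
        ~ (injective f /\ forall a b, a != b -> g i (f a) (f b))) /\
    (forall c : 'I_n -> 'I_r,
        exists (i : 'I_r) (f : 'I_k -> 'I_n),
          injective f /\ (forall a, c (f a) = i) /\
          (forall a b, a != b -> g i (f a) (f b))).

Definition is_least (P : nat -> Prop) (n : nat) : Prop :=
  P n /\ forall m, P m -> n <= m.

(* Main.v *)
(** Deleting a vertex v of a minimal Ramsey graph leaves a K_(k+1)-free
    colouring; on the neighbourhood of v it is a packing pattern, because every
    vertex colouring of N(v) describes a colouring of the edges at v. So every
    value of s_r is a packing size.

    Conversely, the class of K_(k+1)-free colour patterns has the edge-Ramsey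
    property (Nesetril-Roedl, by the partite construction over the Hales-Jewett
    theorem): for a pattern F there is a pattern E such that every r-colouring
    chi of the edges of E admits a homomorphism F -> E along which chi is a
    function phi of the original colour. Let F contain the packing pattern and,
    for each pair of colours, a K_(k+1) using exactly these two. If chi has no
    monochromatic K_(k+1), then phi is injective, so chi contains the packing
    pattern up to a permutation of the colours, and a new vertex joined to the
    image of that pattern creates a monochromatic K_(k+1). Hence E together with
    a new vertex for each possible image arrows K_(k+1) while E does not, and a
    minimal Ramsey subgraph contains a new vertex, of degree at most n. This
    replaces signal senders. *)

Require Import Defs.
From mathcomp Require Import all_boot.
From Stdlib Require Import Classical.

Set Implicit Arguments.
Unset Strict Implicit.
Unset Printing Implicit Defensive.

(** * Pigeonhole and Ramsey's theorem for ordered pairs *)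

Lemma count_pigeonhole (C : finType) (T : Type) (h : T -> C) (s : seq T) n :
  0 < #|C| -> #|C| * n <= size s -> exists c, n <= count (fun y => h y == c) s.
Proof.
move=> C_gt0 le_s.
have size_sum : size s = \sum_(c : C) count (fun y => h y == c) s.
  elim: s {le_s} => [|y s IHs] /=; first by rewrite big1.
  rewrite big_split /= -IHs (bigD1 (h y)) //= eqxx big1 ?addn0 // => c.
  by rewrite eq_sym => /negPf ->.
apply/existsP; rewrite -[X in is_true X]negbK negb_exists.
apply/negP => /forallP small.
have: \sum_(c : C) (count (fun y => h y == c) s).+1 <= \sum_(c : C) n.
  by apply: leq_sum => c _; rewrite ltnNge.
rewrite sum_nat_const; under eq_bigr do rewrite -addn1.
rewrite big_split /= -size_sum sum_nat_const muln1 => /leq_trans/(_ le_s).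
by rewrite -[X in _ <= X]addn0 leq_add2l leqNgt C_gt0.
Qed.

(** Greedy choice: keep the head [x] and continue inside its most popular colour class. Each chosen
    element is stored with the colour it sends to all later ones. *)
Lemma end_homogeneous_seq (C : finType) (n : nat) : 0 < #|C| ->
  exists N, forall (T : eqType) (psi : T -> T -> C) (s : seq T),
    N <= size s -> uniq s ->
  exists t : seq (T * C),
    [/\ size t = n, {subset map fst t <= s} &
        pairwise (fun p q => (p.1 != q.1) && (psi p.1 q.1 == p.2)) t].
Proof.
move=> C_gt0; elim: n => [|n [N IHn]]; first by exists 0 => T psi s _ _; exists [::].
exists (#|C| * N).+1 => T psi [|x s] //= le_s /andP[xNs s_uniq].
have [c le_c] := count_pigeonhole (psi x) C_gt0 le_s.
rewrite -size_filter in le_c.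
have [t [size_t sub_t pair_t]] := IHn _ psi _ le_c (filter_uniq _ s_uniq).
exists ((x, c) :: t); split=> /=; first by rewrite size_t.
  move=> y; rewrite !inE => /orP[->//|/sub_t].
  by rewrite mem_filter => /andP[_ ->]; rewrite orbT.
rewrite pair_t andbT; apply/allP => q q_t /=.
have: q.1 \in map fst t by apply: map_f.
move/sub_t; rewrite mem_filter => /andP[-> qs]; rewrite andbT.
by apply: contra xNs => /eqP ->.
Qed.

(** A second pigeonhole, on the stored colours. As [psi] may be asymmetric, only pairs in increasing
    order are controlled. *)
Lemma ramsey_pairs (V C : finType) : 0 < #|C| ->
  exists N, forall psi : 'I_N -> 'I_N -> C,
  exists (g : V -> 'I_N) (c : C), forall u v,
    enum_rank u < enum_rank v -> g u != g v /\ psi (g u) (g v) = c.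
Proof.
move=> C_gt0; have [N ramseyN] := end_homogeneous_seq (#|C| * #|V|) C_gt0.
exists N => psi.
have [||t [size_t _ pair_t]] := ramseyN _ psi (enum 'I_N).
- by rewrite size_enum_ord.
- exact: enum_uniq.
have [|c le_c] := @count_pigeonhole C _ snd t #|V| C_gt0.
  by rewrite size_t.
set t' := take #|V| [seq p <- t | p.2 == c].
have size_t' : size t' == #|V| by rewrite size_takel // size_filter.
have pair_t' : pairwise (fun p q => (p.1 != q.1) && (psi p.1 q.1 == c)) t'.
  have t'c : all (fun p => p.2 == c) t'.
    by apply/allP => p /mem_take; rewrite mem_filter => /andP[].
  have sub_t' : subseq t' t.
    exact: subseq_trans (take_subseq _ _) (filter_subseq _ _).
  have := subseq_pairwise sub_t' pair_t.
  by apply: sub_in_pairwise t'c => p q /eqP <- _.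
exists (fun u => (tnth (Tuple size_t') (enum_rank u)).1), c => u v lt_uv.
set p0 := tnth (Tuple size_t') (enum_rank u).
rewrite /p0 !(tnth_nth p0) /=.
have := pairwiseP p0 pair_t' (enum_rank u) (enum_rank v).
by rewrite !inE (eqP size_t') !ltn_ord => /(_ isT isT lt_uv) /andP[-> /eqP].
Qed.

(** * The Hales-Jewett theorem by colour focusing *)

(** A combinatorial line is a word over [option A] in which [None] marks the variable
    coordinates. *)
Definition line_point (A D : finType) (L : {ffun D -> option A}) (a : A) :
  {ffun D -> A} := [ffun s => odflt a (L s)].

Definition ffun_cat (A D1 D2 : finType) (u : {ffun D1 -> A}) (v : {ffun D2 -> A}) :
  {ffun D1 + D2 -> A} :=
  [ffun s => match s with inl s1 => u s1 | inr s2 => v s2 end].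

Lemma line_point_cat (A D1 D2 : finType) (L : {ffun D1 -> option A})
    (M : {ffun D2 -> option A}) a :
  line_point (ffun_cat L M : {ffun _ -> _}) a =
  ffun_cat (line_point L a) (line_point M a).
Proof. by apply/ffunP => -[s|s]; rewrite !ffunE. Qed.

Definition const_line (A D : finType) (w : {ffun D -> A}) : {ffun D -> option A} :=
  [ffun s => Some (w s)].

Lemma line_point_const (A D : finType) (w : {ffun D -> A}) a :
  line_point (const_line w) a = w.
Proof. by apply/ffunP => s; rewrite !ffunE. Qed.

Definition mono_line (A D C : finType) (S : seq A) (chi : {ffun D -> A} -> C)
    (L : {ffun D -> option A}) : Prop :=
  (exists s, L s = None) /\
  {in S &, forall a b, chi (line_point L a) = chi (line_point L b)}.

Lemma mono_line_cons (A D C : finType) (z a0 : A) (S : seq A)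
    (chi : {ffun D -> A} -> C) L :
  a0 \in S -> mono_line S chi L ->
  chi (line_point L z) = chi (line_point L a0) -> mono_line (z :: S) chi L.
Proof.
move=> a0S [varL monoL] eq_z; split=> //.
have to_a0 a : a \in z :: S -> chi (line_point L a) = chi (line_point L a0).
  by rewrite inE => /orP[/eqP ->//|aS]; apply: monoL.
by move=> a b /to_a0 -> /to_a0 ->.
Qed.

(** Restricting constancy to letters of [S] allows induction on the alphabet while the type [A]
    stays fixed. *)
Definition hales_jewett_on (A : finType) (S : seq A) : Prop :=
  forall C : finType, exists D : finType,
  forall chi : {ffun D -> A} -> C, exists L, mono_line S chi L.

(* Colour focusing: all lines in Ls meet in the focus f = L(z), and they carry
   distinct colours on S, all different from that of the focus. *)
Lemma colour_focusing (A C : finType) (z a0 : A) (S : seq A) n :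
  a0 \in S -> hales_jewett_on S ->
  exists D : finType, forall chi : {ffun D -> A} -> C,
    (exists L, mono_line (z :: S) chi L) \/
    exists f (Ls : seq {ffun D -> option A}),
      [/\ size Ls = n,
          forall L, L \in Ls -> mono_line S chi L /\ line_point L z = f &
          uniq (chi f :: [seq chi (line_point L a0) | L <- Ls])].
Proof.
move=> a0S hjS; elim: n => [|n [D IHn]].
  by exists void => chi; right; exists [ffun=> z], [::].
(* A word over [D'] is coloured by the whole colouring it induces on words over [D], so along [M]
   the colour is constant for every choice of the [D] part. *)
have [D' hjD'] := hjS {ffun {ffun D -> A} -> C}.
exists (D' + D)%type => chi.
have [M [[s Ms] monoM]] := hjD' (fun u => [ffun v => chi (ffun_cat u v)]).
have M_eq a b v : a \in S -> b \in S ->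
    chi (ffun_cat (line_point M a) v) = chi (ffun_cat (line_point M b) v).
  by move=> aS bS; have /ffunP/(_ v) := monoM a b aS bS; rewrite !ffunE.
pose chi0 v := chi (ffun_cat (line_point M a0) v).
have catM L : mono_line S chi0 L -> mono_line S chi (ffun_cat M L).
  move=> [_ monoL]; split; first by exists (inl s); rewrite ffunE.
  move=> a b aS bS; rewrite !line_point_cat.
  by rewrite (M_eq a a0) // (M_eq b a0) //; apply: monoL.
have [[L [[s' Ls'] monoL]]|[f [Ls [size_Ls focus uniq_Ls]]]] := IHn chi0.
  left; exists (ffun_cat (const_line (line_point M a0)) L); split.
    by exists (inr s'); rewrite ffunE.
  by move=> a b aS bS; rewrite !line_point_cat !line_point_const; apply: monoL.
have const_f : mono_line S chi (ffun_cat M (const_line f)).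
  split; first by exists (inl s); rewrite ffunE.
  by move=> a b aS bS; rewrite !line_point_cat !line_point_const; apply: M_eq.
set f' := ffun_cat (line_point M z) f.
set Ls' := ffun_cat M (const_line f) :: [seq ffun_cat M L | L <- Ls].
have colours : [seq chi (line_point L a0) | L <- Ls'] =
               chi0 f :: [seq chi0 (line_point L a0) | L <- Ls].
  rewrite /= line_point_cat line_point_const -map_comp; congr (_ :: _).
  by apply: eq_map => L /=; rewrite line_point_cat.
have focus' L : L \in Ls' -> mono_line S chi L /\ line_point L z = f'.
  rewrite inE => /orP[/eqP ->|/mapP[L0 /focus[mono0 f0] ->]].
    by rewrite line_point_cat line_point_const.
  by split; [apply: catM | rewrite line_point_cat f0].
(* If the focus repeats the colour of a focused line, that line stays monochromatic with [z]
   added. *)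
case: (boolP (chi f' \in [seq chi (line_point L a0) | L <- Ls'])).
  case/mapP=> L /focus'[monoL zL] eqL; left; exists L.
  by apply: (mono_line_cons a0S monoL); rewrite zL.
move=> f'_new; right; exists f', Ls'; split=> //.
  by rewrite /= size_map size_Ls.
by rewrite cons_uniq f'_new colours.
Qed.

Lemma hales_jewett (A C : finType) : exists D : finType,
  forall chi : {ffun D -> A} -> C, exists L : {ffun D -> option A},
    (exists s, L s = None) /\
    forall a b, chi (line_point L a) = chi (line_point L b).
Proof.
suff hj (S : seq A) : hales_jewett_on S.
  have [D hjD] := hj (enum A) C; exists D => chi.
  have [L [varL monoL]] := hjD chi; exists L; split=> // a b.
  by apply: monoL; rewrite mem_enum.
elim: S => [|z [|a0 S] IHS] C'.
- by exists unit => chi; exists [ffun=> None]; split=> //; exists tt; rewrite ffunE.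
- exists unit => chi; exists [ffun=> None]; split; first by exists tt; rewrite ffunE.
  by move=> a b; rewrite !inE => /eqP -> /eqP ->.
have [D focusD] := colour_focusing C' z #|C'| (mem_head a0 S) IHS.
exists D => chi; have [//|[f [Ls [size_Ls _ uniq_Ls]]]] := focusD chi.
(* Together with the focus, the lines would use [#|C'| + 1] distinct colours. *)
have := max_card (mem (chi f :: [seq chi (line_point L a0) | L <- Ls])).
by rewrite (card_uniqP uniq_Ls) /= size_map size_Ls ltnn.
Qed.

(** * Amalgamating copies of a pattern along combinatorial lines *)

Definition clique_free_pattern (r m : nat) (T : finType) (E : 'I_r -> rel T) : Prop :=
  [/\ forall i, simple_graph (E i),
      forall i j x y, E i x y -> E j x y -> i = j &
      forall i (f : 'I_m -> T), ~ (forall a b, a != b -> E i (f a) (f b))].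

(** Reconciles [clique_free_pattern] with the injective copies in [packing_ok] and
    [arrows_clique]. *)
Lemma clique_injective (m : nat) (T : finType) (e : rel T) (f : 'I_m -> T) :
  simple_graph e -> (forall a b, a != b -> e (f a) (f b)) -> injective f.
Proof.
move=> [_ irr] clique a b eq_ab; apply/eqP; apply: contraT => /clique.
by rewrite eq_ab (negPf (irr _)).
Qed.

Section LineAmalgam.

Variables (T B D : finType) (p : T -> B) (F : rel T) (x y : B).

(** The Hales-Jewett alphabet: a word over it is a [D]-tuple of edges, that is, a pair of points of
    the power T^D. *)
Definition cross_edge : finType := {uv : T * T | [&& F uv.1 uv.2, p uv.1 == x & p uv.2 == y]}.

(* A copy of T for every line; the parts over x and y of all copies are glued
   inside the single power T^D. *)
Definition amalgam : finType := ({ffun D -> option cross_edge} * T + {ffun D -> T})%type.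

Definition amalgam_part (w : amalgam) : B :=
  match w with
  | inl Lu => p Lu.2
  | inr w => if [forall s, p (w s) == x] then x else y
  end.

Definition line_copy (L : {ffun D -> option cross_edge}) (u : T) : amalgam :=
  if p u == x then inr [ffun s => if L s is Some e then (val e).1 else u]
  else if p u == y then inr [ffun s => if L s is Some e then (val e).2 else u]
  else inl (L, u).

(** Without a variable, [line_copy] would collapse the part over [x] to one point. *)
Definition has_variable (L : {ffun D -> option cross_edge}) : bool :=
  [exists s, L s == None].

Definition amalgam_edge (e : rel T) : rel amalgam := fun a b =>
  [exists L, [exists u, [exists v,
    [&& has_variable L, e u v, a == line_copy L u & b == line_copy L v]]]].

Lemma amalgam_edgeP (e : rel T) a b :
  reflect (exists L u v, [/\ has_variable L, e u v, a = line_copy L u & b = line_copy L v])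
          (amalgam_edge e a b).
Proof.
apply: (iffP existsP) => [[L /existsP[u /existsP[v /and4P[]]]]|[L [u [v []]]]].
  by move=> hL euv /eqP -> /eqP ->; exists L, u, v.
move=> hL euv -> ->; exists L; apply/existsP; exists u; apply/existsP; exists v.
by rewrite hL euv !eqxx.
Qed.

Hypothesis neq_xy : x != y.

Lemma line_copy_part L u : has_variable L -> amalgam_part (line_copy L u) = p u.
Proof.
move=> /existsP[s /eqP Ls]; rewrite /line_copy.
have [pu|pNx] := eqVneq (p u) x.
  rewrite /= ifT //; apply/forallP => t; rewrite ffunE.
  by case: (L t) => [e|]; [case/and3P: (valP e) | rewrite pu].
have [pu|//] := eqVneq (p u) y; rewrite /= ifF //.
by apply/negP => /forallP/(_ s); rewrite ffunE Ls (negPf pNx).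
Qed.

Lemma line_copy_inj L : has_variable L -> injective (line_copy L).
Proof.
move=> hL u v eq_uv.
have eq_p : p u = p v by rewrite -(line_copy_part u hL) eq_uv line_copy_part.
move: eq_uv; rewrite /line_copy -eq_p.
have /existsP[s /eqP Ls] := hL.
by case: ifP => _; [|case: ifP => _]; case=> // /ffunP/(_ s); rewrite !ffunE Ls.
Qed.

(* If the edge uv lies in the copies along L and L', then at a variable of L'
   it is the original edge, while at a variable of L it is either the original
   edge or an edge of F; disjointness of e and F excludes the mixed cases. *)
Lemma line_copy_edge_xy (e : rel T) L L' u v u' v' :
  (e =2 F \/ forall a b, e a b -> ~~ F a b) ->
  has_variable L -> has_variable L' ->
  p u = x -> p v = y -> e u' v' ->
  line_copy L u = line_copy L' u' -> line_copy L v = line_copy L' v' -> e u v.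
Proof.
move=> eF hL hL' pu pv e' eq_u eq_v.
have pu' : p u' = x by rewrite -pu -(line_copy_part u hL) eq_u line_copy_part.
have pv' : p v' = y by rewrite -pv -(line_copy_part v hL) eq_v line_copy_part.
move: eq_u eq_v; rewrite /line_copy pu pu' pv pv' !eqxx.
rewrite eq_sym (negPf neq_xy) => -[/ffunP eq_u] [/ffunP eq_v].
have /existsP[s /eqP Ls] := hL; have /existsP[s' /eqP Ls'] := hL'.
case: eF => [eF|eF].
  move: (eq_u s) (eq_v s); rewrite !ffunE Ls.
  case: (L' s) => [d|] -> -> //; rewrite eF.
  by case/and3P: (valP d).
move: (eq_u s') (eq_v s'); rewrite !ffunE Ls'.
case: (L s') => [d|] eq_u' eq_v'; last by rewrite eq_u' eq_v'.
by have := eF _ _ e'; rewrite -eq_u' -eq_v'; case/and3P: (valP d) => ->.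
Qed.

(** Copies are induced subgraphs. An endpoint outside the parts [x] and [y] determines its copy, so
    [L = L']; otherwise the edge runs between these two parts. *)
Lemma line_copy_edge (e : rel T) L L' u v u' v' :
  (e =2 F \/ forall a b, e a b -> ~~ F a b) -> symmetric e ->
  (forall a b, e a b -> p a != p b) ->
  has_variable L -> has_variable L' -> e u' v' ->
  line_copy L u = line_copy L' u' -> line_copy L v = line_copy L' v' -> e u v.
Proof.
move=> eF e_sym proper hL hL' e' eq_u eq_v.
have pu : p u = p u' by rewrite -(line_copy_part u hL) eq_u line_copy_part.
have pv : p v = p v' by rewrite -(line_copy_part v hL) eq_v line_copy_part.
have outside w w' : p w = p w' -> p w != x -> p w != y ->
    line_copy L w = line_copy L' w' -> L = L' /\ w = w'.
  by rewrite /line_copy => <- /negPf -> /negPf -> [-> ->].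
have aligned : L = L' -> e u v.
  move=> eqL; move: eq_u eq_v; rewrite -eqL.
  by move/(line_copy_inj hL) => ->; move/(line_copy_inj hL) => ->.
have [out_u|] := boolP ((p u != x) && (p u != y)).
  by case/andP: out_u => ux uy; have [/aligned] := outside u u' pu ux uy eq_u.
have [out_v|] := boolP ((p v != x) && (p v != y)).
  by case/andP: out_v => vx vy; have [/aligned] := outside v v' pv vx vy eq_v.
have := proper _ _ e'; rewrite -pu -pv !negb_and !negbK.
move=> neq /orP[]/eqP pv0 /orP[]/eqP pu0; rewrite pu0 pv0 ?eqxx // in neq.
  by rewrite e_sym; rewrite e_sym in e'; apply: line_copy_edge_xy e' eq_v eq_u.
exact: line_copy_edge_xy e' eq_u eq_v.
Qed.

End LineAmalgam.

(** * The partite construction and the edge-Ramsey property *)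

Definition properly_parted (r : nat) (T B : finType) (E : 'I_r -> rel T) (p : T -> B) :=
  forall j u v, E j u v -> p u != p v.

Definition has_type (r : nat) (T B : finType) (E : 'I_r -> rel T) (p : T -> B)
    (t : B * B * 'I_r) (u v : T) : bool :=
  [&& E t.2 u v, p u == t.1.1 & p v == t.1.2].

Definition constant_on_type (r : nat) (T B C : finType) (E : 'I_r -> rel T)
    (p : T -> B) (chi : T -> T -> C) (t : B * B * 'I_r) : Prop :=
  forall u v u' v', has_type E p t u v -> has_type E p t u' v' -> chi u v = chi u' v'.

(** One type of edges is treated: a monochromatic line for the colouring of words is a copy of the
    pattern whose edges of that type all get one colour. *)
Lemma partite_step (r m : nat) (T B C : finType) (E : 'I_r -> rel T) (p : T -> B)
    (t : B * B * 'I_r) :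
  2 < m -> clique_free_pattern m E -> properly_parted E p ->
  exists (T' : finType) (E' : 'I_r -> rel T') (p' : T' -> B),
    [/\ clique_free_pattern m E', properly_parted E' p' &
    forall chi : T' -> T' -> C, exists f : T -> T',
      [/\ forall u, p' (f u) = p u, forall j u v, E j u v -> E' j (f u) (f v) &
          constant_on_type E p (fun u v => chi (f u) (f v)) t]].
Proof.
case: t => -[x y] i m_gt2 [simpleE disjE freeE] properE.
(* Inside a single part there are no edges, hence none of this type. *)
have [eq_xy|neq_xy] := eqVneq x y.
  exists T, E, p; split=> // chi; exists id; split=> // u v u' v'.
  by case/and3P=> /= /properE/eqP neq /eqP pu /eqP pv; case: neq; rewrite pu pv.
pose F := E i; have [D hjD] := hales_jewett (cross_edge p F x y) C.
pose copy := @line_copy T B D p F x y.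
pose E' j := @amalgam_edge T B D p F x y (E j).
pose p' := @amalgam_part T B D p F x y.
have dichotomy j : E j =2 F \/ forall a b, E j a b -> ~~ F a b.
  have [->|neq_ji] := eqVneq j i; [by left | right=> a b Ej].
  by apply: contra neq_ji => /(disjE _ _ _ _ Ej) ->.
have part L u : has_variable L -> p' (copy L u) = p u by exact: line_copy_part.
have induced j L u v : has_variable L -> E' j (copy L u) (copy L v) -> E j u v.
  move=> hL /amalgam_edgeP[L' [u' [v' [hL' e' eq_u eq_v]]]].
  apply: (line_copy_edge neq_xy _ _ _ hL hL' e' eq_u eq_v) => //.
    by case: (simpleE j).
  exact: properE.
have proper' : properly_parted E' p'.
  move=> j a b /amalgam_edgeP[L [u [v [hL euv -> ->]]]].
  by rewrite !part //; apply: properE euv.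
exists (amalgam D p F x y), E', p'; split=> //.
- split=> [j|j l a b|j f clique].
  + split=> [a b|a]; last first.
      by apply/negP => /proper'; rewrite eqxx.
    apply/amalgam_edgeP/amalgam_edgeP => -[L [u [v [hL euv -> ->]]]];
      by exists L, v, u; split=> //; case: (simpleE j) => ->.
  + case/amalgam_edgeP=> L [u [v [hL euv -> ->]]] /(induced _ _ _ _ hL).
    exact: disjE euv.
  (* A clique meeting a private vertex of some copy lies inside that copy,
     while a clique in T^D meets only the parts over x and y. *)
  + case: (pickP (fun a => if f a is inl _ then true else false)) => [a|glued].
      case fa: (f a) => [[L u]|//] _.
      have in_copy b : b != a -> has_variable L /\ exists w, f b = copy L w.
        rewrite eq_sym => /clique; rewrite fa.
        case/amalgam_edgeP=> L' [u' [v' [hL' _ eq_u ->]]].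
        suff <- : L' = L by split=> //; exists v'.
        by move: eq_u; rewrite /line_copy; do 2!case: ifP => // _; case.
      have [b neq_ba] : exists b, b != a.
        have le1 : 1 < m by exact: ltnW.
        have [eq0|] := eqVneq (Ordinal le1) a; last by exists (Ordinal le1).
        by exists (Ordinal (ltnW le1)); rewrite -eq0.
      have [hL _] := in_copy b neq_ba.
      have [w fw] : exists w, forall c, f c = copy L (w c).
        apply: (@fin_all_exists _ (fun _ => T) (fun c w => f c = copy L w)) => c.
        have [->|/in_copy[_ //]] := eqVneq c a.
        have := clique _ _ neq_ba; rewrite fa.
        case/amalgam_edgeP=> L' [_ [v' [hL' _ _ eq_v]]].
        suff eqL : L' = L by exists v'; rewrite eq_v eqL.
        by move: eq_v; rewrite /line_copy; do 2!case: ifP => // _; case.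
      apply: (freeE j w) => c d /clique; rewrite !fw.
      exact: induced.
    have part_f a : p' (f a) \in [:: x; y].
      have := glued a; case: (f a) => //= w _.
      by case: ifP; rewrite !inE eqxx ?orbT.
    have inj_pf : injective (fun a => p' (f a)).
      by move=> a b /eqP; apply: contraTeq => /clique /proper'.
    have := uniq_leq_size (s1 := [seq p' (f a) | a <- enum 'I_m]) (s2 := [:: x; y]).
    rewrite (map_inj_uniq inj_pf) enum_uniq size_map size_enum_ord /= leqNgt m_gt2.
    by move=> ge; suff: false by []; apply: ge => // _ /mapP[a _ ->].
- move=> chi.
  (* A word of edges gets the colour of the pair formed by its tuples of first and second
     endpoints. *)
  pose chi0 (w : {ffun D -> cross_edge p F x y}) :=
    chi (inr [ffun s => (val (w s)).1]) (inr [ffun s => (val (w s)).2]).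
  have [L [[s Ls] monoL]] := hjD chi0.
  have hL : has_variable L by apply/existsP; exists s; rewrite Ls.
  exists (copy L); split=> [u|j u v euv|]; first exact: part.
    by apply/amalgam_edgeP; exists L, u, v.
  have to_word u v (typed : has_type E p (x, y, i) u v) :
      chi (copy L u) (copy L v) = chi0 (line_point L (exist _ (u, v) typed)).
    case/and3P: (typed) => /= _ /eqP pu /eqP pv.
    rewrite /copy /line_copy pu pv eqxx eq_sym (negPf neq_xy) eqxx /chi0.
    by congr (chi (inr _) (inr _)); apply/ffunP => s'; rewrite !ffunE; case: (L s').
  by move=> u v u' v' typed typed'; rewrite (to_word _ _ typed) (to_word _ _ typed').
Qed.

(** The step is iterated over the types. Its maps preserve types, so constancy obtained in the
    larger pattern pulls back along [f]. *)
Lemma partite_construction (r m : nat) (T B C : finType) (E : 'I_r -> rel T)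
    (p : T -> B) (ts : seq (B * B * 'I_r)) :
  2 < m -> clique_free_pattern m E -> properly_parted E p ->
  exists (T' : finType) (E' : 'I_r -> rel T'),
    clique_free_pattern m E' /\
    forall chi : T' -> T' -> C, exists f : T -> T',
      (forall j u v, E j u v -> E' j (f u) (f v)) /\
      forall t, t \in ts -> constant_on_type E p (fun u v => chi (f u) (f v)) t.
Proof.
move=> m_gt2; elim: ts T E p => [|t ts IHts] T E p freeE properE.
  by exists T, E; split=> // chi; exists id.
have [T1 [E1 [p1 [free1 proper1 step]]]] := partite_step C t m_gt2 freeE properE.
have [T' [E' [free' rest]]] := IHts _ _ _ free1 proper1.
exists T', E'; split=> // chi; have [g [hom_g const_g]] := rest chi.
have [f [part_f hom_f const_f]] := step (fun u v => chi (g u) (g v)).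
exists (g \o f); split=> [j u v /hom_f/hom_g //|t'].
rewrite inE => /orP[/eqP -> //|ts_t'].
have lift u v : has_type E p t' u v -> has_type E1 p1 t' (f u) (f v).
  by case/and3P=> /hom_f euv pu pv; apply/and3P; rewrite !part_f.
by move=> u v u' v' /lift typed /lift; apply: const_g.
Qed.

Lemma clique_free_pattern_ramsey (r m : nat) (V : finType) (E : 'I_r -> rel V) :
  2 < m -> clique_free_pattern m E ->
  exists (T : finType) (E' : 'I_r -> rel T),
    clique_free_pattern m E' /\
    forall chi : T -> T -> 'I_r, (forall u v, chi u v = chi v u) ->
    exists (f : V -> T) (phi : 'I_r -> 'I_r),
      forall j u v, E j u v -> E' j (f u) (f v) /\ chi (f u) (f v) = phi j.
Proof.
move=> m_gt2 [simpleE disjE freeE].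
have C_gt0 : 0 < #|{ffun 'I_r -> 'I_r}|.
  by apply/card_gt0P; exists [ffun j => j].
have [N ramseyN] := ramsey_pairs V C_gt0.
(* One copy of [V] for each map z from [V] to ['I_N]; its vertex v lies in part z(v). *)
pose T0 := ({ffun V -> 'I_N} * V)%type; pose p0 (w : T0) : 'I_N := w.1 w.2.
pose E0 j : rel T0 := fun a b => [&& a.1 == b.1, E j a.2 b.2 & p0 a != p0 b].
have free0 : clique_free_pattern m E0.
  split=> [j|j l a b /and3P[_ ej _] /and3P[_ el _]|j f clique].
  - have [sym irr] := simpleE j; split=> [a b|a]; rewrite /E0.
      by rewrite eq_sym sym [p0 a == _]eq_sym.
    by rewrite (negPf (irr _)) andbF.
  - exact: disjE ej el.
  - by apply: (freeE j (fun a => (f a).2)) => a b /clique/and3P[].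
have proper0 : properly_parted E0 p0 by move=> j a b /and3P[].
have [T [E' [free' homog]]] :=
  partite_construction 'I_r (enum {: 'I_N * 'I_N * 'I_r}) m_gt2 free0 proper0.
exists T, E'; split=> // chi chi_sym; have [h [hom_h const_h]] := homog chi.
(* On edges the colour now depends only on the two parts and the original colour, and [psi] records
   this; the default [j] covers types without edges. *)
pose psi (x y : 'I_N) : {ffun 'I_r -> 'I_r} := [ffun j : 'I_r =>
  if [pick ab : T0 * T0 | has_type E0 p0 (x, y, j) ab.1 ab.2] is Some ab
  then chi (h ab.1) (h ab.2) else j].
have psiE j a b : E0 j a b -> psi (p0 a) (p0 b) j = chi (h a) (h b).
  move=> eab; rewrite ffunE; have typed : has_type E0 p0 (p0 a, p0 b, j) a b.
    by rewrite /has_type eab !eqxx.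
  case: pickP => [ab typed'|/(_ (a, b))]; last by rewrite typed.
  by apply: (const_h (p0 a, p0 b, j)) typed' typed; rewrite mem_enum.
have [g [phi homog_g]] := ramseyN psi.
(* The copy indexed by the homogeneous map [g] itself. *)
exists (fun u => h ([ffun z => g z], u)), phi => j u v euv.
wlog lt_uv : u v euv / enum_rank u < enum_rank v => [wlog_lt|].
  have [sym irr] := simpleE j.
  case: (ltngtP (enum_rank u) (enum_rank v)) => [|lt_vu|].
  - exact: wlog_lt.
  - rewrite chi_sym; have [|e' ->] := wlog_lt v u _ lt_vu; first by rewrite sym.
    by split=> //; case: free' => simple' _ _; case: (simple' j) => ->.
  - move=> /val_inj/enum_rank_inj eq_uv; rewrite eq_uv in euv.
    by rewrite (negPf (irr v)) in euv.
have [neq_g psi_g] := homog_g u v lt_uv.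
have e0 : E0 j ([ffun z => g z], u) ([ffun z => g z], v).
  by rewrite /E0 /p0 /= !ffunE eqxx euv neq_g.
by split; [apply: hom_h | rewrite -(psiE _ _ _ e0) /p0 /= !ffunE -psi_g ffunE].
Qed.

(** * Minimal Ramsey subgraphs *)

Lemma exists_least (P : nat -> Prop) n : P n -> exists m, is_least P m.
Proof.
elim/ltn_ind: n => n IHn Pn.
have [[m lt_mn Pm]|no_less] := classic (exists2 m, m < n & P m); first exact: IHn Pm.
exists n; split=> // m Pm; rewrite leqNgt; apply/negP => lt_mn.
by apply: no_less; exists m.
Qed.

Definition edge_set (T : finType) (e : rel T) : {set T * T} := [set uv | e uv.1 uv.2].

Lemma arrows_clique_reindex (r m : nat) (T : finType) (A : {set T}) (e : rel T) :
  0 < r -> 0 < m -> arrows_clique r m A e ->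
  arrows_clique r m [set: 'I_#|A|] (fun x y => e (enum_val x) (enum_val y)).
Proof.
move=> r_gt0 m_gt0 arrowsA c c_sym; pose i0 := Ordinal r_gt0.
(* Any clique serves here: it supplies the point of [A] that [enum_rank_in] requires. *)
have [_ [f0 [_ [f0A _]]]] := arrowsA (fun _ _ => i0) (fun _ _ => erefl).
pose rank := enum_rank_in (f0A (Ordinal m_gt0)).
have [i [f [f_inj [fA clique]]]] :=
  arrowsA (fun u v => c (rank u) (rank v)) (fun u v => c_sym _ _).
have rankK a : enum_val (rank (f a)) = f a by rewrite enum_rankK_in.
exists i, (fun a => rank (f a)); split=> [a b eq_ab|].
  by apply: f_inj; rewrite -rankK eq_ab rankK.
by split=> [a|a b /clique[]]; rewrite ?in_setT // !rankK.
Qed.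

(** Descent on the number of vertices plus ordered edges; a proper arrowing subgraph is renumbered
    by an ordinal before recursing. *)
Lemma ramsey_minimal_subgraph (r m N : nat) (e : rel 'I_N) :
  0 < r -> 0 < m -> simple_graph e -> arrows_clique r m [set: 'I_N] e ->
  exists (N' : nat) (e' : rel 'I_N') (h : 'I_N' -> 'I_N),
    [/\ ramsey_minimal r m e', injective h & forall x y, e' x y -> e (h x) (h y)].
Proof.
move=> r_gt0 m_gt0; have [s] := ubnP (N + #|edge_set e|).
elim: s N e => // s IHs N e lt_s simple_e arrows_e.
have [min_e|not_min] := classic (ramsey_minimal r m e).
  by exists N, e, id; split.
have [A [e1 [simple1 sub1 sup1 proper1 arrows1]]] : exists (A : {set 'I_N}) (e1 : rel 'I_N),
    [/\ simple_graph e1, forall x y, e1 x y -> e x y,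
        forall x y, e1 x y -> x \in A /\ y \in A,
        A != [set: 'I_N] \/ (exists x y, e x y && ~~ e1 x y) &
        arrows_clique r m A e1].
  apply: NNPP => none; apply: not_min; split=> //; split=> // A e1 *.
  by move=> ?; apply: none; exists A, e1.
pose e2 (x y : 'I_#|A|) := e1 (enum_val x) (enum_val y).
have edges_e2 : #|edge_set e2| <= #|edge_set e1|.
  rewrite -(card_imset _ (f := fun xy => (enum_val xy.1, enum_val xy.2))).
    by apply/subset_leq_card/subsetP => _ /imsetP[xy + ->]; rewrite !inE.
  by move=> [x y] [x' y'] [/enum_val_inj -> /enum_val_inj ->].
have edges_e1 : edge_set e1 \subset edge_set e.
  by apply/subsetP => xy; rewrite !inE; apply: sub1.
have smaller : #|A| + #|edge_set e2| < N + #|edge_set e|.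
  have le_A : #|A| <= N by rewrite -[X in _ <= X]card_ord max_card.
  have le_e := leq_trans edges_e2 (subset_leq_card edges_e1).
  case: proper1 => [neqA|[x [y /andP[exy Ne1]]]].
    rewrite -addSn leq_add //.
    by rewrite -[X in _ < X]card_ord -cardsT proper_card // properEneq neqA subsetT.
  rewrite -addnS leq_add // (leq_ltn_trans edges_e2) // proper_card //.
  rewrite properE edges_e1; apply/subsetPn; exists (x, y); first by rewrite inE.
  by rewrite inE.
have [] := IHs #|A| e2.
- exact: leq_trans smaller lt_s.
- by have [sym irr] := simple1; split=> [x y|x]; [apply: sym | apply: irr].
- exact: arrows_clique_reindex.
move=> N' [e' [h [min' h_inj hom]]].
exists N', e', (fun x => enum_val (h x)); split=> // [x y /enum_val_inj/h_inj //|].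
by move=> x y /hom/sub1.
Qed.

Lemma arrows_clique_exists (r m : nat) : 0 < r ->
  exists N, arrows_clique r m [set: 'I_N] (fun x y => x != y).
Proof.
move=> r_gt0; have [|N ramseyN] := @ramsey_pairs 'I_m 'I_r; first by rewrite card_ord.
exists N => c c_sym; have [g [i homog]] := ramseyN c.
have clique a b : a != b -> g a != g b /\ c (g a) (g b) = i.
  move=> neq_ab; case: (ltngtP (enum_rank a) (enum_rank b)) => [/homog //||].
    by rewrite eq_sym c_sym => /homog.
  by move/val_inj/enum_rank_inj/eqP; rewrite (negPf neq_ab).
exists i, g; split=> [a b /eqP eq_g|]; last by split=> // a; rewrite in_setT.
by apply/eqP; apply: contraLR eq_g => /clique[].
Qed.

Lemma ramsey_minimal_vertex (r m N : nat) (e : rel 'I_N) : 0 < r -> 0 < m ->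
  ramsey_minimal r m e -> exists v : 'I_N, true.
Proof.
move=> r_gt0 m_gt0 [_ [arrows_e _]].
have [_ [f _]] := arrows_e (fun _ _ => Ordinal r_gt0) (fun _ _ => erefl).
by exists (f (Ordinal m_gt0)).
Qed.

Lemma sr_value_le_degree (r m N : nat) (e : rel 'I_N) (v : 'I_N) :
  ramsey_minimal r m e -> exists2 d, d <= degree e v & sr_value r m d.
Proof.
move=> min_e; case: (arg_minnP (P := predT) (i0 := v) (degree e)) => // u _ le_u.
exists (degree e u); first exact: le_u.
by exists N, e; split=> //; split; [exists u | move=> w; apply: le_u].
Qed.

(** * From minimal Ramsey graphs to packing patterns *)

Lemma packing_ok_sr_value (r k d : nat) : 0 < r -> sr_value r k.+1 d -> packing_ok r k d.
Proof.
move=> r_gt0 [N [e [[[e_sym e_irr] [arrows_e min_e]] [[v <-] _]]]].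
pose A := [set~ v]; pose e1 : rel 'I_N := fun x y => [&& e x y, x \in A & y \in A].
(* By minimality the graph without [v] does not arrow, which yields the colouring [c]. *)
have [c [c_sym no_mono]] : exists c : 'I_N -> 'I_N -> 'I_r,
    (forall x y, c x y = c y x) /\ forall i (f : 'I_k.+1 -> 'I_N),
    injective f -> (forall a, f a \in A) ->
    ~ (forall a b, a != b -> e (f a) (f b) /\ c (f a) (f b) = i).
  apply: NNPP => none; apply: (min_e A e1).
  - split=> [x y|x]; rewrite /e1; first by rewrite e_sym [in RHS]andbCA andbA andbC andbA.
    by rewrite (negPf (e_irr x)).
  - by move=> x y /and3P[].
  - by move=> x y /and3P[].
  - by left; apply/eqP => /setP/(_ v); rewrite !inE eqxx.
  move=> c c_sym; apply: NNPP => no_mono; apply: none; exists c; split=> // i f f_inj fA.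
  move=> clique; apply: no_mono; exists i, f; split=> //; split=> // a b /clique[eab ->].
  by rewrite /e1 eab !fA.
pose nb (x : 'I_(degree e v)) : 'I_N := enum_val x.
have nbP x : e v (nb x) by have := enum_valP x; rewrite inE.
have nb_inj : injective nb by exact: enum_val_inj.
have nbA x : nb x \in A.
  by rewrite !inE; apply: contraNneq (e_irr v) => {2}<-.
exists (fun i x y => e (nb x) (nb y) && (c (nb x) (nb y) == i)); split.
  by move=> i; split=> [x y|x]; [rewrite e_sym c_sym | rewrite (negPf (e_irr _))].
split; first by move=> i j x y /andP[_ /eqP <-] /andP[_ /eqP].
split=> [i f [f_inj clique]|c'].
  apply: (no_mono i (nb \o f)) => [|a|a b /clique/andP[? /eqP]] //=.
  exact: inj_comp.
pose c1 u := if [pick x | nb x == u] is Some x then c' x else c v v.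
have c1E x : c1 (nb x) = c' x.
  rewrite /c1; case: pickP => [y /eqP/nb_inj -> //|/(_ x)]; by rewrite eqxx.
(* The vertex colouring of the neighbourhood becomes the colouring of the edges at [v]. *)
pose chi x y := if x == v then c1 y else if y == v then c1 x else c x y.
have [|i [f [f_inj [_ clique]]]] := arrows_e chi.
  move=> x y; rewrite /chi; case: (eqVneq x v) => [->|_]; last by case: ifP.
  by case: (eqVneq y v) => [->|].
(* The monochromatic clique must pass through [v]; its other k vertices, reindexed by [lift a], are
   neighbours of [v]. *)
have [a /eqP fa|avoid] := pickP (fun a => f a == v); last first.
  case: (no_mono i f f_inj) => [a|a b /clique[]]; first by rewrite !inE avoid.
  by rewrite /chi !avoid.
have f_lift (b : 'I_k) : exists x, f (lift a b) = nb x.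
  have [+ _] := clique a (lift a b) (neq_lift a b); rewrite fa => eb.
  have nb_b : f (lift a b) \in [set u | e v u] by rewrite inE.
  by exists (enum_rank_in nb_b (f (lift a b))); rewrite /nb enum_rankK_in.
have [g gE] := fin_all_exists f_lift.
exists i, g; split=> [b b' eq_g|].
  by apply: (@lift_inj _ a); apply: f_inj; rewrite !gE eq_g.
split=> [b|b b' neq_b].
  by have [_ <-] := clique a (lift a b) (neq_lift a b); rewrite /chi fa eqxx gE c1E.
have neq_lift_b : lift a b != lift a b' by rewrite (inj_eq (@lift_inj _ a)).
have [+ <-] := clique _ _ neq_lift_b.
have nv x : (nb x == v) = false by apply: negbTE; have := nbA x; rewrite !inE.
by rewrite /chi !gE !nv eqxx andbT.
Qed.

(** * From packing patterns to minimal Ramsey graphs of small degree *)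

(* The disjoint union of g with, for all colours i and j, a K_m having the edge
   {0, 1} in colour i and all other edges in colour j. *)
Definition augmented_pattern (r m : nat) (V : finType) (g : 'I_r -> rel V)
    (l : 'I_r) : rel (V + 'I_r * 'I_r * 'I_m) := fun u v =>
  match u, v with
  | inl x, inl y => g l x y
  | inr (i, j, a), inr (i', j', b) =>
      [&& (i, j) == (i', j'), i != j, a != b &
          l == if (a < 2) && (b < 2) then i else j]
  | _, _ => false
  end.

(** A clique stays in one component. In an added K_m it would use all vertices, but {0, 1} has
    colour [i] and {0, 2} has colour [j], with [i != j]. *)
Lemma augmented_clique_free (r m : nat) (V : finType) (g : 'I_r -> rel V) :
  2 < m -> clique_free_pattern m g -> clique_free_pattern m (@augmented_pattern r m V g).
Proof.
move=> m_gt2 [simple_g disj_g free_g].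
split=> [l|l l' [x|[[i j] a]] [y|[[i' j'] b]] //=|l f clique].
- have [sym irr] := simple_g l.
  split=> [[x|[[i j] a]] [y|[[i' j'] b]]|[x|[[i j] a]]] //=.
    rewrite (eq_sym b a) [(b < 2) && _]andbC (eq_sym (i', j')).
    by case: eqP => //= -[-> ->].
  by rewrite !eqxx /= andbF.
- exact: disj_g.
- by move=> /and4P[_ _ _ /eqP ->] /and4P[_ _ _ /eqP ->].
pose a0 : 'I_m := Ordinal (ltnW (ltnW m_gt2)).
pose a1 : 'I_m := Ordinal (ltnW m_gt2).
pose a2 : 'I_m := Ordinal m_gt2.
case fa0: (f a0) => [x0|[[i j] b0]].
  have f_inl a : exists x, f a = inl x.
    have [<-|/clique] := eqVneq a0 a; first by exists x0.
    by rewrite fa0; case: (f a) => // x; exists x.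
  have [h hE] := fin_all_exists f_inl.
  by apply: (free_g l h) => a b /clique; rewrite !hE.
have f_inr a : exists b, f a = inr (i, j, b).
  have [<-|/clique] := eqVneq a0 a; first by exists b0.
  by rewrite fa0; case: (f a) => // -[[i' j'] b] /and4P[/eqP[<- <-] _ _ _]; exists b.
have [h hE] := fin_all_exists f_inr.
have edge (a b : 'I_m) : a != b -> [&& i != j, h a != h b &
    l == if (h a < 2) && (h b < 2) then i else j].
  by move=> /clique; rewrite !hE /= eqxx.
have h_inj : injective h.
  by move=> a b /eqP; apply: contraTeq => /edge/and3P[].
have [h' hK hK'] := injF_bij h_inj.
have colour (b b' : 'I_m) : b != b' -> l = if (b < 2) && (b' < 2) then i else j.
  move=> neq_b; have neq_h' : h' b != h' b'.
    by apply: contra neq_b => /eqP/(can_inj hK') ->.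
  by have /and3P[_ _ /eqP] := edge _ _ neq_h'; rewrite !hK'.
have [/= li] := colour a0 a1 isT; have [/= lj] := colour a0 a2 isT.
by have := edge a0 a1 isT; rewrite -li -lj eqxx.
Qed.

(* A vertex for every map from 'I_n to T, joined to the image of that map. *)
Definition cone_graph (n : nat) (T : finType) (e : rel T) : rel (T + {ffun 'I_n -> T}) :=
  fun u v => match u, v with
  | inl x, inl y => e x y
  | inl x, inr q | inr q, inl x => x \in codom q
  | inr _, inr _ => false
  end.

Lemma packing_ok_degree (r k n : nat) : 1 < r -> 1 < k -> packing_ok r k n ->
  exists2 d, d <= n & sr_value r k.+1 d.
Proof.
move=> r_gt1 k_gt1 [g [simple_g [disj_g [free_g forced]]]].
have r_gt0 := ltnW r_gt1; pose i0 := Ordinal r_gt0.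
have m_gt2 : 2 < k.+1 by [].
have clique_free_g : clique_free_pattern k.+1 g.
  split=> // i f clique; apply: (free_g i f); split=> //.
  exact: clique_injective clique.
have [T [E [[simpleE disjE freeE] homog]]] :=
  clique_free_pattern_ramsey m_gt2 (augmented_clique_free m_gt2 clique_free_g).
pose e : rel T := fun x y => [exists i, E i x y].
pose G := @cone_graph n T e.
have e_simple : simple_graph e.
  split=> [x y|x]; first by apply: eq_existsb => i; case: (simpleE i).
  by rewrite negb_exists; apply/forallP => i; case: (simpleE i).
have G_simple : simple_graph G.
  have [e_sym e_irr] := e_simple.
  by split=> [[x|p] [y|q]|[x|p]] //=.
have G_arrows : arrows_clique r k.+1 setT G.
  move=> c c_sym.
  have mono i (f : 'I_k.+1 -> T + {ffun 'I_n -> T}) :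
      (forall a b, a != b -> G (f a) (f b) /\ c (f a) (f b) = i) ->
      exists (i : 'I_r) (f : 'I_k.+1 -> T + {ffun 'I_n -> T}),
      injective f /\ (forall a, f a \in setT) /\
      (forall a b, a != b -> G (f a) (f b) /\ c (f a) (f b) = i).
    move=> clique; exists i, f; split; last by split=> // a; rewrite in_setT.
    by apply: (clique_injective G_simple) => a b /clique[].
  have [f [phi hom_f]] := homog (fun x y => c (inl x) (inl y)) (fun x y => c_sym _ _).
  have edge_f j u v : augmented_pattern g j u v ->
      G (inl (f u)) (inl (f v)) /\ c (inl (f u)) (inl (f v)) = phi j.
    by move=> /hom_f[ej ->]; split=> //; apply/existsP; exists j.
  (* If phi merges two colours, then a two-coloured K_(k+1) of the augmented
     pattern becomes monochromatic. *)
  have [/injectiveP phi_inj|/injectivePn[i [j neq_ij eq_phi]]] := boolP (injectiveb phi);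
      last first.
    apply: (mono (phi i) (fun a => inl (f (inr (i, j, a))))) => a b neq_ab.
    pose l := if (a < 2) && (b < 2) then i else j.
    have [|eG ->] := edge_f l (inr (i, j, a)) (inr (i, j, b)).
      by rewrite /= eqxx neq_ij neq_ab eqxx.
    by split=> //; rewrite /l; case: ifP.
  have [psi phiK psiK] := injF_bij phi_inj.
  pose q : {ffun 'I_n -> T} := [ffun s => f (inl s)].
  (* The edges from the cone vertex [q] to the copy colour its vertices; [psi], the inverse of
     [phi], translates them into the colours of [g]. *)
  have [i [h [h_inj [h_col clique]]]] := forced (fun s => psi (c (inr q) (inl (q s)))).
  have h_col' a : c (inr q) (inl (q (h a))) = phi i by rewrite -(h_col a) psiK.
  apply: (mono (phi i) (fun a => if unlift ord0 a is Some b then inl (q (h b)) else inr q)).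
  move=> a b; case: unliftP => [a'|] ->; case: unliftP => [b'|] ->.
  - rewrite (inj_eq (@lift_inj _ ord0)) => /clique eg.
    by rewrite !ffunE; apply: edge_f.
  - by rewrite c_sym h_col' /= codom_f.
  - by rewrite h_col' /= codom_f.
  - by rewrite eqxx.
have {}G_arrows := arrows_clique_reindex r_gt0 (ltn0Sn k) G_arrows.
have [|N [e' [h [min_e' h_inj hom_h]]]] := ramsey_minimal_subgraph r_gt0 (ltn0Sn k) _ G_arrows.
  by have [G_sym G_irr] := G_simple; split=> [x y|x]; [apply: G_sym | apply: G_irr].
pose w x := enum_val (h x).
have w_inj : injective w by move=> x y /enum_val_inj/h_inj.
have [v new|old] := pickP (fun v => if w v is inr _ then true else false); last first.
  (* Without a cone vertex, all edges of [e'] come from the pattern [E]; colouring each by its index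
     there leaves no monochromatic clique. *)
  pose lab (i : 'I_r) (u v : T + {ffun 'I_n -> T}) :=
    if (u, v) is (inl x, inl y) then E i x y else false.
  have lab_sym i u v : lab i u v = lab i v u.
    by rewrite /lab; case: u v => [x|p] [y|q] //=; have [-> _] := simpleE i.
  have [[e'_sym e'_irr] [arrows' _]] := min_e'.
  have [|i [f [f_inj [_ clique]]]] :=
    arrows' (fun x y => odflt i0 [pick i | lab i (w x) (w y)]).
    by move=> x y; congr odflt; apply: eq_pick => i; apply: lab_sym.
  have f_inl a : exists t, w (f a) = inl t.
    by have := old (f a); case: (w (f a)) => // t; exists t.
  have [t tE] := fin_all_exists f_inl.
  case: (freeE i t) => a b /clique[/hom_h].
  rewrite -/(w (f a)) -/(w (f b)) !tE /= => /existsP[j ej].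
  by case: pickP => [l /= el <- //|/(_ j)]; rewrite /lab /= ej.
case wv: (w v) new => [//|q] _.
have [d le_d sr_d] := sr_value_le_degree v min_e'.
(* Cone vertices are pairwise non-adjacent, so every neighbour of [v] maps into the image of [q],
   which has at most n points. *)
exists d => //; apply: leq_trans le_d _; rewrite /degree -(card_imset _ w_inj).
have card_n : #|[set: 'I_n]| = n by rewrite cardsT card_ord.
rewrite -[X in _ <= X]card_n.
apply: leq_trans (leq_imset_card (fun s => inl (q s) : T + {ffun 'I_n -> T}) setT).
apply/subset_leq_card/subsetP => _ /imsetP[u + ->].
rewrite inE => /hom_h; rewrite -/(w v) -/(w u) wv.
by case: (w u) => //= t /codomP[s ->]; apply: imset_f; rewrite in_setT.
Qed.

Theorem theorem4 (r k : nat) : 2 <= r -> 2 <= k ->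
  exists n : nat, is_least (sr_value r k.+1) n /\ is_least (packing_ok r k) n.
Proof.
move=> r_gt1 k_gt1; have r_gt0 := ltnW r_gt1.
have [N arrowsN] := arrows_clique_exists k.+1 r_gt0.
have [|N' [e [_ [min_e _ _]]]] := ramsey_minimal_subgraph r_gt0 (ltn0Sn k) _ arrowsN.
  by split=> [x y|x]; [rewrite eq_sym | rewrite eqxx].
have [v _] := ramsey_minimal_vertex r_gt0 (ltn0Sn k) min_e.
have [d _ sr_d] := sr_value_le_degree v min_e.
have [n [ok_n least_n]] := exists_least (packing_ok_sr_value r_gt0 sr_d).
have [d' le_d' sr_d'] := packing_ok_degree r_gt1 k_gt1 ok_n.
(* The value [d'] is at most [n] and is itself a packing size, so minimality of [n] gives
   equality. *)
have eq_n : d' = n.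
  by apply/eqP; rewrite eqn_leq le_d' least_n //; apply: packing_ok_sr_value sr_d'.
exists n; split; split=> //; first by rewrite -eq_n.
by move=> m /(packing_ok_sr_value r_gt0)/least_n.
Qed.
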